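(* Let $\hat K$ be a finite simplicial complex and let $(u,v)$ be a pair of vertices of $\hat K$ satisfying the link condition. Let $f':\hat K\to K'$ be the elementary collapse sending $u,v\mapsto u$ and fixing all other vertices, with induced homomorphism $H^p(\hat K)\stackrel{f'^*}{\leftarrow}H^p(K')$. Let $[\phi_1],\dots,[\phi_g]$ be a basis of $H^p(\hat K)$ given by a valid annotation. Let $\phi_1',\dots,\phi_g'$ be the cochains that correspond to the annotation computed for $K'$ by the update algorithm. Then $[\phi_i]=f'^*([\phi_i'])$ for $i=1,\dots,g$.
   Context: Simplicial homology and cohomology are taken with $\mathbb{Z}_2$ coefficients; simplices are nonempty. Annotations. An annotation for the $p$-simplices of $\hat K$ assigns to each $p$-simplex $\sigma$ a vector $\mathsf a_\sigma\in\mathbb{Z}_2^{g}$ ($g$ depending only on $p$), extended to $p$-chains by $\mathsf a_c=\sum_{\sigma\in c}\mathsf a_\sigma$. It is valid if $g=\mathrm{rank}\,H_p(\hat K)$ and any two $p$-cycles $z_1,z_2$ satisfy $\mathsf a_{z_1}=\mathsf a_{z_2}$ iff $[z_1]=[z_2]$. The cochains corresponding to an annotation are $\phi_i(\sigma)=\mathsf a_\sigma[i]$ ($i$-th entry), $1\le i\le g$; for a valid annotation they are cocycles whose classes form a basis of $H^p(\hat K)$. The complex $\hat K$ carries a valid annotation in every dimension. Link condition. For a simplex $\sigma$, $\mathrm{Lk}\,\sigma$ is the set of simplices $\omega$ disjoint from $\sigma$ with $\omega\cup\sigma\in\hat K$. The pair $(u,v)$ satisfies the link condition if $\{u,v\}\in\hat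 K$ and $\mathrm{Lk}\,u\cap\mathrm{Lk}\,v=\mathrm{Lk}\{u,v\}$. The elementary collapse $f'$ is the simplicial map onto $K'=f'(\hat K)$ induced by the stated vertex map. Update algorithm for the collapse $f'$. Annotation transfer: for every simplex $\sigma\in\hat K$ containing both $u$ and $v$ (a vanishing simplex), of dimension $q$, one after another, add the current $\mathsf a_\sigma$ to the annotations of all $q$-simplices of $\hat K$ containing $\sigma\setminus\{v\}$ (including $\sigma$). After this, vanishing simplices have zero annotation and any two mirror simplices ($\omega\cup\{u\}$ and $\omega\cup\{v\}$ with $u,v\notin\omega$) have equal annotations. Collapse: delete the vanishing simplices and replace $v$ by $u$ in every remaining simplex containing $v$, keeping annotations; i.e. a simplex of $K'$ gets the common annotation of the non-vanishing simplices of $\hat K$ of the same dimension mapped onto it by $f'$. *)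

(* Defs.v *)
From HB Require Import structures.
From mathcomp Require Import all_boot all_order all_algebra.

Set Implicit Arguments.
Unset Strict Implicit.
Unset Printing Implicit Defensive.

Import GRing.Theory.
Local Open Scope ring_scope.
Local Open Scope quotient_scope.

(* The quotient Z / (Z :&: B) of a subspace Z by a subspace B, as a vector
   space; for B <= Z this is Z / B. *)
Section QuotientSpace.
Variables (F : fieldType) (vT : vectType F) (Z B : {vspace vT}).

Definition vquot_rel (x y : subvs_of Z) : bool := vsval x - vsval y \in B.

Lemma vquot_rel_refl : reflexive vquot_rel.
Proof. by move=> x; rewrite /vquot_rel subrr mem0v. Qed.

Lemma vquot_rel_sym : symmetric vquot_rel.
Proof. by move=> x y; rewrite /vquot_rel -memvN opprB. Qed.

Lemma vquot_rel_trans : transitive vquot_rel.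
Proof.
by move=> y x z xy yz; rewrite /vquot_rel -(subrKA (vsval y)) memvD.
Qed.

Canonical vquot_equiv :=
  EquivRel vquot_rel vquot_rel_refl vquot_rel_sym vquot_rel_trans.

Definition vquot := {eq_quot vquot_rel}.

HB.instance Definition _ := Choice.on vquot.
HB.instance Definition _ := EqQuotient.on vquot.

Lemma vquot_eqP (x y : subvs_of Z) :
  reflect (\pi_vquot x = \pi_vquot y) (vsval x - vsval y \in B).
Proof. by apply: (iffP idP) => [h|/eqquotP//]; apply/eqquotP. Qed.

Definition vquot_opp (a : vquot) : vquot := \pi_vquot (- repr a).
Definition vquot_add (a b : vquot) : vquot := \pi_vquot (repr a + repr b).
Definition vquot_scale (k : F) (a : vquot) : vquot := \pi_vquot (k *: repr a).

Lemma vquot_reprK (x : subvs_of Z) :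
  vsval (repr (\pi_vquot x)) - vsval x \in B.
Proof. by apply/vquot_eqP; rewrite reprK. Qed.

Lemma pi_vquotN x : vquot_opp (\pi_vquot x) = \pi_vquot (- x).
Proof.
by apply/vquot_eqP; rewrite !linearN /= -linearB memvN vquot_reprK.
Qed.

Lemma pi_vquotD x y :
  vquot_add (\pi_vquot x) (\pi_vquot y) = \pi_vquot (x + y).
Proof.
by apply/vquot_eqP; rewrite !linearD /= addrACA memvD ?vquot_reprK.
Qed.

Lemma pi_vquotZ k x : vquot_scale k (\pi_vquot x) = \pi_vquot (k *: x).
Proof.
by apply/vquot_eqP; have := memvZ k (vquot_reprK x); rewrite scalerBr.
Qed.

Lemma vquot_ind (P : vquot -> Prop) :
  (forall x, P (\pi_vquot x)) -> forall a, P a.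
Proof. by move=> h a; rewrite -[a]reprK. Qed.

Lemma vquot_addA : associative vquot_add.
Proof.
elim/vquot_ind=> x; elim/vquot_ind=> y; elim/vquot_ind=> z.
by rewrite !pi_vquotD addrA.
Qed.

Lemma vquot_addC : commutative vquot_add.
Proof.
by elim/vquot_ind=> x; elim/vquot_ind=> y; rewrite !pi_vquotD addrC.
Qed.

Lemma vquot_add0 : left_id (\pi_vquot 0) vquot_add.
Proof. by elim/vquot_ind=> x; rewrite pi_vquotD add0r. Qed.

Lemma vquot_addN : left_inverse (\pi_vquot 0) vquot_opp vquot_add.
Proof. by elim/vquot_ind=> x; rewrite pi_vquotN pi_vquotD addNr. Qed.

HB.instance Definition _ :=
  GRing.isZmodule.Build vquot vquot_addA vquot_addC vquot_add0 vquot_addN.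

Lemma pi_vquot_add x y : \pi_vquot x + \pi_vquot y = \pi_vquot (x + y).
Proof. exact: pi_vquotD. Qed.

Lemma vquot_scaleA k l a :
  vquot_scale k (vquot_scale l a) = vquot_scale (k * l) a.
Proof. by elim/vquot_ind: a => x; rewrite !pi_vquotZ scalerA. Qed.

Lemma vquot_scale1 : left_id 1 vquot_scale.
Proof. by elim/vquot_ind=> x; rewrite pi_vquotZ scale1r. Qed.

Lemma vquot_scaleDr : right_distributive vquot_scale +%R.
Proof.
move=> k a b; elim/vquot_ind: a => x; elim/vquot_ind: b => y.
by rewrite pi_vquot_add !pi_vquotZ scalerDr pi_vquot_add.
Qed.

Lemma vquot_scaleDl a : {morph vquot_scale^~ a : k l / k + l}.
Proof.
by elim/vquot_ind: a => x k l; rewrite !pi_vquotZ pi_vquot_add scalerDl.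
Qed.

HB.instance Definition _ := GRing.Zmodule_isLmodule.Build F vquot
  vquot_scaleA vquot_scale1 vquot_scaleDr vquot_scaleDl.

Lemma pi_vquot_linear : linear (fun x : subvs_of Z => \pi_vquot x).
Proof.
move=> k x y.
by rewrite -pi_vquot_add; congr (_ + _); rewrite -pi_vquotZ.
Qed.

(* Z :\: B is a complement of Z :&: B in Z, hence isomorphic to the quotient. *)
Lemma vquot_vect_iso : Vector.axiom (\dim (Z :\: B)) vquot.
Proof.
pose D := (Z :\: B)%VS; pose P := addv_pi1 Z B.
have DB0 : (D :&: B = 0)%VS by exact: capv_diff.
have PB b : b \in B -> P b = 0.
  move=> Bb; have := addv_pi1_pi2 (subvP (addvSr Z B) _ Bb).
  by rewrite addv_pi2_id // => /(canRL (addrK _)); rewrite subrr.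
have [h h_lin h_bij] := subvs_vect_iso D.
pose f (a : vquot) := h (vsproj D (P (vsval (repr a)))).
have fE x : f (\pi_vquot x) = h (vsproj D (P (vsval x))).
  rewrite /f; congr (h (vsproj D _)).
  by have := PB _ (vquot_reprK x); rewrite linearB => /subr0_eq.
exists f.
  move=> k; elim/vquot_ind=> x; elim/vquot_ind=> y.
  by rewrite -pi_vquot_linear !fE (linearP vsval) (linearP P) linearP h_lin.
have [h' hK h'K] := h_bij.
exists (fun r => \pi_vquot (vsproj Z (vsval (h' r)))).
  elim/vquot_ind=> x; rewrite fE hK vsprojK ?memv_pi //.
  apply/vquot_eqP; rewrite vsprojK ?memv_pi1 //.
  have := addv_pi1_pi2 (subvP (addvSl Z B) _ (subvsP x)).
  by move=> {2}<-; rewrite opprD addNKr memvN memv_pi2.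
move=> r; have rZ : vsval (h' r) \in Z.
  exact: subvP (diffvSl Z B) _ (subvsP _).
by rewrite fE vsprojK // daddv_pi_id ?subvsP // vsvalK h'K.
Qed.

HB.instance Definition _ := Lmodule_hasFinDim.Build F vquot vquot_vect_iso.

(* The class of x modulo B; meaningful only for x \in Z, where
   vsval (vsproj Z x) = x. *)
Definition vquot_class (x : vT) : vquot := \pi_vquot (vsproj Z x).

End QuotientSpace.

Section SimplicialComplex.
Variable V : finType.
Implicit Type K : {set {set V}}.

(* The vertices of K are the x : V with [set x] \in K; V may be larger. *)
Definition simplicial_complex K : Prop :=
  set0 \notin K /\
  forall s t : {set V}, s \in K -> t \subset s -> t != set0 -> t \in K.

Definition link K (s : {set V}) : {set {set V}} :=
  [set w in K | [disjoint w & s] & w :|: s \in K].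

Definition link_condition K (u v : V) : Prop :=
  [set u; v] \in K /\
  link K [set u] :&: link K [set v] = link K [set u; v].

Record psimplex K (p : nat) : predArgType := PSimplex {
  simplex_set :> {set V};
  _ : (simplex_set \in K) && (#|simplex_set| == p.+1) }.

HB.instance Definition _ K p := [isSub of psimplex K p for @simplex_set K p].
HB.instance Definition _ K p := [Finite of psimplex K p by <:].

End SimplicialComplex.

(* As the coefficients are Z_2, chains and cochains are both functions from
   p-simplices to 'F_2; a set of p-simplices is the function with that support
   and no orientation is needed. *)
Definition chain (V : finType) (K : {set {set V}}) (p : nat) :=
  {ffun psimplex K p -> ('F_2)^o}.
HB.instance Definition _ (V : finType) (K : {set {set V}}) p :=
  Vector.on (chain K p).
Notation cochain := chain (only parsing).

Section Homology.
Variables (V : finType) (K : {set {set V}}).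

Definition boundary_fun p (c : chain K p.+1) : chain K p :=
  [ffun t : psimplex K p => \sum_(s : psimplex K p.+1 | t \subset s) c s].

Definition coboundary_fun p (c : cochain K p) : cochain K p.+1 :=
  [ffun s : psimplex K p.+1 => \sum_(t : psimplex K p | t \subset s) c t].

Lemma boundary_is_linear p : linear (@boundary_fun p).
Proof.
move=> k c d; apply/ffunP=> t; rewrite !ffunE scaler_sumr -big_split.
by apply: eq_bigr => s _; rewrite !ffunE.
Qed.

Lemma coboundary_is_linear p : linear (@coboundary_fun p).
Proof.
move=> k c d; apply/ffunP=> t; rewrite !ffunE scaler_sumr -big_split.
by apply: eq_bigr => s _; rewrite !ffunE.
Qed.

HB.instance Definition _ p := GRing.isLinear.Build 'F_2
  (chain K p.+1) (chain K p) *:%R (@boundary_fun p) (@boundary_is_linear p).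
HB.instance Definition _ p := GRing.isLinear.Build 'F_2
  (cochain K p) (cochain K p.+1) *:%R (@coboundary_fun p)
  (@coboundary_is_linear p).

Definition boundary p : 'Hom(chain K p.+1, chain K p) :=
  linfun (@boundary_fun p).
Definition coboundary p : 'Hom(cochain K p, cochain K p.+1) :=
  linfun (@coboundary_fun p).

Definition cycles p : {vspace chain K p} :=
  match p with 0 => fullv | q.+1 => lker (boundary q) end.
Definition boundaries p : {vspace chain K p} := limg (boundary p).

Definition cocycles p : {vspace cochain K p} := lker (coboundary p).
Definition coboundaries p : {vspace cochain K p} :=
  match p with 0 => 0%VS | q.+1 => limg (coboundary q) end.

Definition homology p : vectType 'F_2 := vquot (cycles p) (boundaries p).
Definition cohomology p : vectType 'F_2 := vquot (cocycles p) (coboundaries p).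

Definition hclass p (z : chain K p) : homology p := vquot_class _ _ z.
Definition cohclass p (c : cochain K p) : cohomology p := vquot_class _ _ c.

Definition pannotation (p n : nat) := psimplex K p -> 'rV['F_2]_n.

Definition annotation (g : nat -> nat) := forall p, pannotation p (g p).

Definition chain_annotation p n (a : pannotation p n) (c : chain K p) :
    'rV['F_2]_n := \sum_s (c s : 'F_2) *: a s.

Definition valid_annotation p n (a : pannotation p n) : Prop :=
  n = \dim {: homology p} /\
  forall z1 z2, z1 \in cycles p -> z2 \in cycles p ->
    chain_annotation a z1 = chain_annotation a z2 <-> hclass z1 = hclass z2.

Definition annotation_cochain p n (a : pannotation p n) (i : 'I_n) :
  cochain K p := [ffun s => a s 0 i].

End Homology.

(* For a simplicial map f from K to L, (pullback f c) s is c (f s) when f s has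
   the dimension of s and 0 otherwise: insub fails exactly in the latter case. *)
Definition pullback (V W : finType) (K : {set {set V}}) (L : {set {set W}})
    (f : V -> W) p (c : cochain L p) : cochain K p :=
  [ffun s : psimplex K p => oapp c 0 (insub (f @: (s : {set V})))].

(* The map on cohomology, computed on a representing cocycle; when f is
   simplicial the result does not depend on the representative. *)
Definition induced (V W : finType) (K : {set {set V}}) (L : {set {set W}})
    (f : V -> W) p (x : cohomology L p) : cohomology K p :=
  cohclass (pullback K f (vsval (repr x))).

Section Collapse.
Variables (V : finType) (K : {set {set V}}) (u v : V) (g : nat -> nat).

Definition collapse_map (x : V) : V := if x == v then u else x.

Definition collapse : {set {set V}} :=
  [set collapse_map @: (s : {set V}) | s in K].

Definition vanishing : {set {set V}} :=
  [set s in K | (u \in s) && (v \in s)].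

(* The case None occurs when t does not have the dimension of s. *)
Definition transfer_step (a : annotation K g) (s : {set V}) :
    annotation K g :=
  fun q t =>
    if insub s is Some s' then
      if s :\ v \subset t then a q t + a q s' else a q t
    else a q t.

Definition transfer (a : annotation K g) (ord : seq {set V}) :
  annotation K g := foldl transfer_step a ord.

(* A simplex of K of the same dimension as its image t is not vanishing.  At
   most two such simplices have image t, and these are mirror simplices. *)
Definition collapse_annotation (a : annotation K g) : annotation collapse g :=
  fun q t =>
    if [pick s : psimplex K q | collapse_map @: (s : {set V}) == t :> {set V}]
    is Some s then a q s else 0.

Definition update (a : annotation K g) (ord : seq {set V}) :
  annotation collapse g := collapse_annotation (transfer a ord).

End Collapse.

Arguments transfer_step {V K} v {g} a s q t : rename.
Arguments transfer {V K} v {g} a ord q t : rename.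
Arguments collapse_annotation {V K} u v {g} a q t : rename.
Arguments update {V K} u v {g} a ord q t : rename.

(* Main.v *)
(* Adding a_s to every q-simplex containing s minus v changes the annotation
   cochain phi by a_s times the coboundary of the indicator of s minus v, so
   the transferred cochain psi is a cocycle cohomologous to phi.  It vanishes
   on the simplices containing u and v, and since the link condition puts the
   union of two mirror simplices into K, the cocycle equation on that union says
   that psi agrees on the two.  Hence psi is exactly the pullback of phi', and
   the claim follows as the pullback is a cochain map. *)
Require Import Defs.
From mathcomp Require Import all_boot all_order all_algebra.

Set Implicit Arguments.
Unset Strict Implicit.
Unset Printing Implicit Defensive.

Import GRing.Theory.
Local Open Scope ring_scope.

Lemma addrrF2 (x : 'F_2) : x + x = 0.
Proof. by apply: addrr_pchar2; apply: pchar_Fp. Qed.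

(** * Faces, coboundaries and annotation cocycles over F_2 *)

Section Simplices.
Variables (V : finType) (K : {set {set V}}).
Hypothesis K_complex : simplicial_complex K.

Lemma psimplex_in p (s : psimplex K p) : (s : {set V}) \in K.
Proof. by have /andP[] := valP s. Qed.

Lemma card_psimplex p (s : psimplex K p) : #|(s : {set V})| = p.+1.
Proof. by have /andP[_ /eqP] := valP s. Qed.

Lemma card_face p (S : psimplex K p.+1) x :
  x \in (S : {set V}) -> #|S :\ x| = p.+1.
Proof. by move=> xS; have := cardsD1 x S; rewrite xS card_psimplex => -[]. Qed.

Lemma psimplex_face p (S : psimplex K p.+1) x :
  x \in (S : {set V}) -> S :\ x \in K.
Proof.
move=> xS; have [_ /(_ S (S :\ x))] := K_complex.
apply; [exact: psimplex_in | exact: subD1set | by rewrite -card_gt0 card_face].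
Qed.

(** Extending a cochain by 0 to all vertex sets lets faces [S :\ x] be evaluated without a proof
    that they are simplices; the body of [pullback] has this same form. *)
Definition eval_set p (c : cochain K p) (A : {set V}) : 'F_2 :=
  oapp c 0 (insub A).

Lemma eval_setE p (c : cochain K p) (s : psimplex K p) (A : {set V}) :
  A = s -> eval_set c A = c s.
Proof. by move=> ->; rewrite /eval_set valK. Qed.

(** The [p]-simplices inside [S] are the sets [S :\ x], one for each vertex. The hypothesis concerns
    the faces of this [S] alone, so that the formula also serves in the target of a simplicial
    map. *)
Lemma coboundary_sum p (c : cochain K p) (S : psimplex K p.+1) :
  (forall x, x \in (S : {set V}) -> S :\ x \in K) ->
  coboundary_fun c S = \sum_(x in (S : {set V})) eval_set c (S :\ x).
Proof.
move=> faceK.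
have faceP x : x \in (S : {set V}) -> (S :\ x \in K) && (#|S :\ x| == p.+1).
  by move=> xS; rewrite faceK //= card_face.
have [x0 x0S] : exists x, x \in (S : {set V}).
  by apply/set0Pn; rewrite -card_gt0 card_psimplex.
pose h x : psimplex K p := insubd (PSimplex (faceP x0 x0S)) (S :\ x).
have hE x : x \in (S : {set V}) -> h x = S :\ x :> {set V}.
  by move=> xS; rewrite -[LHS]/(val _) insubdK //; exact: (faceP x xS).
have h_inj : {in (S : {set V}) &, injective h}.
  move=> x y xS yS /(congr1 (@simplex_set _ _ _)); rewrite !hE // => Sxy.
  by have := setD11 x S; rewrite Sxy !inE xS andbT => /negbFE/eqP.
rewrite ffunE (eq_bigr (fun x => c (h x))); last first.
  by move=> x xS; apply: eval_setE; rewrite hE.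
rewrite -(big_imset c h_inj); apply: eq_bigl => t; apply/idP/imsetP => [tS|].
  have /cards1P[x tE] : #|(S : {set V}) :\: t| == 1%N.
    by rewrite cardsDS // !card_psimplex subSnn.
  have xS : x \in (S : {set V}).
    by have /setDP[] : x \in S :\: t by rewrite tE set11.
  exists x => //; apply: val_inj; rewrite /= hE // -tE setDDr setDv set0U.
  by apply/esym/setIidPr.
by move=> [x xS ->]; rewrite hE // subD1set.
Qed.

(** A face [S :\ z] with [z] other than [x] and [y] still contains both, so only the faces opposite
    [x] and [y] contribute. *)
Lemma coboundary_two_faces p (c : cochain K p) (S : psimplex K p.+1) x y :
  x != y -> x \in (S : {set V}) -> y \in (S : {set V}) ->
  (forall r : psimplex K p, x \in (r : {set V}) -> y \in (r : {set V}) ->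
     c r = 0) ->
  coboundary_fun c S = eval_set c (S :\ x) + eval_set c (S :\ y).
Proof.
move=> neq_xy xS yS c0; rewrite coboundary_sum => [|z zS]; last first.
  exact: psimplex_face.
rewrite (bigD1 x) //= (bigD1 y) /= ?yS 1?eq_sym // big1 ?addr0 // => z.
move=> /andP[/andP[zS zx] zy]; rewrite /eval_set; case: insubP => // r _ rE /=.
by apply: c0; rewrite rE !inE 1?eq_sym ?zx ?zy ?xS ?yS // eq_sym zx.
Qed.

Definition delta_chain p (s : psimplex K p) : chain K p :=
  [ffun t => (t == s)%:R].

Lemma coboundary_delta p (s : psimplex K p) (t : psimplex K p.+1) :
  coboundary_fun (delta_chain s) t = (s \subset t)%:R.
Proof.
rewrite ffunE; under eq_bigr do rewrite ffunE.
rewrite big_mkcond (bigD1 s) //= eqxx big1 ?addr0 => [|r /negPf->].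
  by case: ifP.
by case: ifP.
Qed.

(** If [r] lies in [S], the simplices between them are the [S :\ x] with [x] in [S] but not in [r].
    There are (p+3) - (p+1) = 2 of them, which is 0 in F_2. This is the common core of boundary and
    coboundary squaring to zero. *)
Lemma sum_between p (r : psimplex K p) (S : psimplex K p.+2) :
  \sum_(t : psimplex K p.+1 | t \subset S) (r \subset t)%:R = 0 :> 'F_2.
Proof.
(* Read as the coboundary at [S] of this indicator cochain, the sum runs over the vertices of
   [S]. *)
pose c : cochain K p.+1 := [ffun t : psimplex K p.+1 => (r \subset t)%:R].
have := @coboundary_sum _ c S (@psimplex_face _ S).
rewrite ffunE; under eq_bigr do rewrite ffunE; move=> ->.
rewrite (eq_bigr (fun x => ((r \subset S) && (x \notin r))%:R)); last first.
  move=> x xS.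
  rewrite -subsetD1 /eval_set; case: insubP => [t _ tE|] /=.
    by rewrite ffunE -tE.
  by rewrite negb_and psimplex_face //= card_face // eqxx.
have [rS|_] := boolP (r \subset S); last by rewrite big1.
rewrite -natr_sum.
have -> : (\sum_(x in (S : {set V})) (true && (x \notin r)) = #|S :\: r|)%N.
  rewrite -sum1_card big_mkcond [RHS]big_mkcond; apply: eq_bigr => x _.
  by rewrite inE; do 2!case: (x \in _).
by rewrite cardsDS // !card_psimplex subSS -(addn2 p) addKn; apply: val_inj.
Qed.

Lemma boundary_boundary p (c : chain K p.+2) :
  boundary_fun (boundary_fun c) = 0.
Proof.
apply/ffunP=> r; rewrite !ffunE; under eq_bigr do rewrite ffunE big_mkcond.
rewrite exchange_big big1 // => S _.
transitivity
  (c S * \sum_(t : psimplex K p.+1 | t \subset S) (r \subset t)%:R : 'F_2);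
  last by rewrite sum_between mulr0.
rewrite mulr_sumr big_mkcond.
rewrite [RHS]big_mkcond; apply: eq_bigr => t _.
by do 2!case: ifP => // _; rewrite ?mulr1 ?mulr0.
Qed.

Lemma coboundary_coboundary p (c : cochain K p) :
  coboundary_fun (coboundary_fun c) = 0.
Proof.
apply/ffunP=> S; rewrite !ffunE; under eq_bigr do rewrite ffunE big_mkcond.
rewrite exchange_big big1 // => r _.
transitivity
  (c r * \sum_(t : psimplex K p.+1 | t \subset S) (r \subset t)%:R : 'F_2);
  last by rewrite sum_between mulr0.
rewrite mulr_sumr.
by apply: eq_bigr => t _; case: ifP => // _; rewrite ?mulr1 ?mulr0.
Qed.

Lemma cocycleP p (c : cochain K p) :
  reflect (coboundary_fun c = 0) (c \in cocycles K p).
Proof. by rewrite memv_ker lfunE; apply: eqP. Qed.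

Lemma coboundaries_cocycles p : (coboundaries K p <= cocycles K p)%VS.
Proof.
case: p => [|p]; first exact: sub0v.
apply/subvP => _ /memv_imgP[c _ ->]; apply/cocycleP.
by rewrite lfunE /= coboundary_coboundary.
Qed.

Lemma boundaries_cycles p : (boundaries K p <= cycles K p)%VS.
Proof.
case: p => [|p]; first exact: subvf.
apply/subvP => _ /memv_imgP[c _ ->].
by rewrite memv_ker !lfunE /= boundary_boundary.
Qed.

Lemma cohclass_eq p (c d : cochain K p) :
  c \in cocycles K p -> d \in cocycles K p -> c - d \in coboundaries K p ->
  cohclass c = cohclass d.
Proof. by move=> cZ dZ cd; apply/vquot_eqP; rewrite !vsprojK. Qed.

Lemma hclass_boundary p (z : chain K p) :
  z \in boundaries K p -> hclass z = hclass 0.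
Proof.
move=> zB; have zZ := subvP (boundaries_cycles p) _ zB.
by apply/vquot_eqP; rewrite !vsprojK ?mem0v ?subr0.
Qed.

(** The coboundary takes on a (p+1)-simplex [S] the value of entry [i] of the annotation of the
    boundary of [S]. That boundary is null-homologous, so validity gives it the annotation of the
    zero cycle. *)
Lemma annotation_cocycle p n (a : pannotation K p n) i :
  valid_annotation a -> annotation_cochain a i \in cocycles K p.
Proof.
move=> [_ aP]; apply/cocycleP/ffunP => S.
have zB : boundary K p (delta_chain S) \in boundaries K p.
  by rewrite memv_img ?memvf.
have := (aP _ _ (subvP (boundaries_cycles p) _ zB) (mem0v _)).2
  (hclass_boundary zB).
move=> /(congr1 (fun w : 'rV_n => w 0 i)).
rewrite /chain_annotation !summxE [RHS]big1 => [a0|s _]; last first.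
  by rewrite ffunE scale0r mxE.
rewrite [RHS]ffunE; apply: etrans a0; rewrite ffunE big_mkcond.
apply: eq_bigr => t _.
rewrite lfunE /= !ffunE mxE big_mkcond (bigD1 S) //= big1 => [|s /negPf neq_sS].
  by rewrite ffunE eqxx addr0; case: ifP => _; rewrite ?mul1r ?mul0r.
by rewrite ffunE neq_sS; case: ifP.
Qed.

End Simplices.

(** * Pullback of cochains and classes along a simplicial map *)

Section Pullback.
Variables (V W : finType) (K : {set {set V}}) (L : {set {set W}}) (f : V -> W).
Hypothesis K_complex : simplicial_complex K.
Hypothesis f_simplicial : forall s, s \in K -> f @: (s : {set V}) \in L.

(** The identified vertices leave the image with fewer than [p.+1] elements, so [insub] fails. *)
Lemma eval_set_degenerate p (c : cochain L p) (A : {set V}) x y :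
  #|A| = p.+1 -> x \in A -> y \in A -> x != y -> f x = f y ->
  eval_set c (f @: A) = 0.
Proof.
move=> cA xA yA neq_xy fxy; rewrite /eval_set insubF //; apply/negbTE.
rewrite negb_and; apply/orP; right; rewrite -cA.
by apply: contra_neqN neq_xy => /imset_injP; apply.
Qed.

Lemma pullbackB p (c d : cochain L p) :
  pullback K f (c - d) = pullback K f c - pullback K f d.
Proof.
apply/ffunP=> s; rewrite !ffunE; case: insubP => [t _ _|_] /=.
  by rewrite !ffunE.
by rewrite subr0.
Qed.

Lemma eval_pullback p (c : cochain L p) (A : {set V}) :
  A \in K -> #|A| = p.+1 ->
  eval_set (pullback K f c) A = eval_set c (f @: A).
Proof.
move=> AK cA; rewrite {1}/eval_set; case: insubP => [s _ sE|] /=.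
  by rewrite ffunE -[simplex_set s]/(val s) sE.
by rewrite AK cA eqxx.
Qed.

(** If [f] is injective on [S], the faces of the image correspond to those of [S]. If [f] identifies
    [x] and [y], the left side is 0; on the right only the faces opposite [x] and [y] can
    contribute, and these have the same image, so they cancel in F_2. *)
Lemma pullback_coboundary p (c : cochain L p) :
  pullback K f (coboundary_fun c) = coboundary_fun (pullback K f c).
Proof.
apply/ffunP=> S; have SK := psimplex_in S.
have [/dinjectiveP f_inj|/dinjectivePn[x xS [y /andP[neq_yx yS] fxy]]] :=
  boolP (dinjectiveb f (S : {set V})).
  have [T TE] : exists T : psimplex L p.+1, T = f @: (S : {set V}) :> {set W}.
    have TP : (f @: (S : {set V}) \in L) && (#|f @: (S : {set V})| == p.+2).
      by rewrite f_simplicial // card_in_imset // card_psimplex /=.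
    by exists (PSimplex TP).
  have fD1 x : x \in (S : {set V}) -> f @: (S :\ x) = T :\ f x.
    move=> xS; rewrite TE; apply/setP=> w; rewrite !inE.
    apply/imsetP/andP => [[y /setD1P[neq_yx yS] ->]|[neq_w /imsetP[y yS wE]]].
      rewrite imset_f //; split=> //.
      by apply: contra_neq neq_yx => /f_inj; apply.
    by exists y; rewrite // !inE yS andbT; apply: contra_neq neq_w => <-.
  rewrite ffunE -/(eval_set _ _) (@eval_setE _ _ _ _ T) //.
  rewrite !coboundary_sum => [|x xS|x]; first last.
  (* A face of [T] lies in [L] because it is the image of a face of [S]. *)
  - rewrite TE => /imsetP[y yS ->]; rewrite -TE -fD1 //.
    by rewrite f_simplicial ?psimplex_face.
  - exact: psimplex_face.
  rewrite TE big_imset //=; apply: eq_bigr => x xS.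
  by rewrite -TE -fD1 // eval_pullback ?psimplex_face ?card_face.
have neq_xy : x != y by rewrite eq_sym.
rewrite ffunE -/(eval_set _ _).
rewrite (eval_set_degenerate _ (card_psimplex S) xS yS neq_xy fxy).
rewrite (coboundary_two_faces K_complex neq_xy xS yS) => [|r xr yr]; last first.
  rewrite ffunE.
  exact: eval_set_degenerate (card_psimplex r) xr yr neq_xy fxy.
rewrite !eval_pullback ?psimplex_face ?card_face //.
suff -> : f @: (S :\ x) = f @: (S :\ y) by rewrite addrrF2.
have fD z t : z \in (S : {set V}) -> t \in (S : {set V}) -> z != t ->
    f z = f t ->
    f @: (S :\ z) = f @: (S : {set V}).
  move=> zS tS neq_zt fzt; apply/eqP; rewrite eqEsubset imsetS ?subD1set //=.
  rewrite -{1}(setD1K zS) imsetU1 subUset subxx andbT sub1set fzt imset_f //.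
  by rewrite !inE eq_sym neq_zt.
by rewrite (fD x y) // (fD y x).
Qed.

(** [induced] evaluates at the cocycle chosen by [repr], which differs from [c] by a coboundary;
    pullback commutes with the coboundary, so the difference stays one. *)
Lemma cohclass_pullback p (c : cochain L p) :
  c \in cocycles L p ->
  induced K f (cohclass c) = cohclass (pullback K f c).
Proof.
have pullZ (d : cochain L p) : d \in cocycles L p ->
    pullback K f d \in cocycles K p.
  move=> /cocycleP dZ; apply/cocycleP; rewrite -pullback_coboundary dZ.
  by apply/ffunP=> s; rewrite !ffunE; case: insubP => //= t _ _; rewrite ffunE.
move=> cZ; apply: cohclass_eq; try exact: pullZ.
  exact/pullZ/subvsP.
rewrite -pullbackB.
have := @vquot_reprK _ _ _ (coboundaries L p) (vsproj (cocycles L p) c).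
rewrite vsprojK // -/(vquot_class _ _ c) -/(cohclass c).
(* In degree 0 the space of coboundaries is zero by definition, so there is no preimage to pull
   back. *)
move: (_ - c) => d; case: p {c cZ pullZ} d => [|p] d /=.
  rewrite !memv0 => /eqP->; apply/eqP.
  by apply/ffunP=> s; rewrite !ffunE; case: insubP => //= t _ _; rewrite ffunE.
move=> /memv_imgP[e _ ->]; rewrite lfunE /= pullback_coboundary.
by rewrite -[coboundary_fun _](lfunE (@coboundary_fun _ _ p)) memv_img ?memvf.
Qed.

End Pullback.

(** * Effect of the annotation transfer on cochains *)

Section Transfer.
Variables (V : finType) (K : {set {set V}}) (u v : V) (g : nat -> nat).
Hypothesis K_complex : simplicial_complex K.
Hypothesis neq_uv : u != v.

(** In the dimension of [s], the step adds entry [i] of the annotation of [s] times the coboundary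
    of the indicator of [s :\ v]; other dimensions are unchanged. *)
Lemma transfer_step_coboundary (a : annotation K g) s p (i : 'I_(g p)) :
  s \in vanishing K u v ->
  annotation_cochain (transfer_step v a s p) i - annotation_cochain (a p) i
    \in coboundaries K p.
Proof.
move=> /setIdP[sK /andP[us vs]].
case Es: (insub s : option (psimplex K p)) => [s'|]; last first.
  rewrite [X in X \in _](_ : _ = 0) ?mem0v //; apply/ffunP => t.
  by rewrite !ffunE /transfer_step Es subrr.
have s'E : s' = s :> {set V} by move: Es; case: insubP => // r _ <- [<-].
(* Degree 0 is impossible because [s] contains the distinct vertices [u] and [v]; otherwise [s :\ v]
   is a simplex one dimension lower. *)
case: p i s' Es s'E => [|p] i s' Es s'E.
  have /subset_leq_card : [set u; v] \subset s'.
    by rewrite s'E subUset !sub1set us.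
  by rewrite card_psimplex cards2 neq_uv.
have rP : (s :\ v \in K) && (#|s :\ v| == p.+1).
  by rewrite -s'E psimplex_face ?card_face ?s'E //=.
pose d := delta_chain (PSimplex rP).
rewrite [X in X \in _](_ : _ = a p.+1 s' 0 i *: coboundary K p d).
  by rewrite memvZ // memv_img ?memvf.
apply/ffunP => t; rewrite lfunE /= !ffunE.
rewrite -[\sum_(_ | _) _](_ : coboundary_fun d t = _); last by rewrite ffunE.
rewrite coboundary_delta /transfer_step Es /=; case: ifP => _.
  by rewrite mxE addrAC subrr add0r [RHS]mulr1.
by rewrite subrr [RHS]mulr0.
Qed.

Lemma transfer_coboundary (a : annotation K g) (ord : seq {set V}) p
    (i : 'I_(g p)) :
  {subset ord <= vanishing K u v} ->
  annotation_cochain (transfer v a ord p) i - annotation_cochain (a p) i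
    \in coboundaries K p.
Proof.
elim: ord a => [|s ord IH] a sub_ord /=; first by rewrite subrr mem0v.
rewrite -(subrKA (annotation_cochain (transfer_step v a s p) i)) memvD //.
  by apply: IH => t t_ord; rewrite sub_ord // inE t_ord orbT.
by apply: transfer_step_coboundary; rewrite sub_ord // mem_head.
Qed.

(* The only vanishing simplex of dimension dim s containing s :\ v is s. *)
Lemma transfer_step_vanishing (a : annotation K g) s p (t : psimplex K p) :
  s \in vanishing K u v -> (t : {set V}) \in vanishing K u v ->
  transfer_step v a s p t = if s == t then 0 else a p t.
Proof.
move=> /setIdP[sK /andP[us vs]] /setIdP[tK /andP[ut vt]].
rewrite /transfer_step; case: insubP => [s' _ s'E|]; last first.
  rewrite sK /= => cs; case: (s =P t) => // st.
  by rewrite st card_psimplex eqxx in cs.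
have -> : (s :\ v \subset t) = (s == t).
  rewrite -s'E /= eqEcard !card_psimplex leqnn andbT.
  apply/idP/idP => [h|]; last exact: subset_trans (subD1set _ _).
  rewrite -(setD1K (a := v) (A := s')) ?subUset ?sub1set ?vt //.
  by rewrite -[simplex_set _]/(val s') s'E.
case: eqP => // st; have -> : s' = t by apply: val_inj; rewrite /= -st.
by apply/rowP=> j; rewrite !mxE addrrF2.
Qed.

(** Peel off the last step: either it processes [t] itself and clears it, or [t] was cleared earlier
    and a step for another vanishing simplex leaves it alone. *)
Lemma transfer_vanishing (a : annotation K g) (ord : seq {set V}) p
    (t : psimplex K p) :
  {subset ord <= vanishing K u v} -> (t : {set V}) \in ord ->
  transfer v a ord p t = 0.
Proof.
elim/last_ind: ord => // ord s IH sub_ord.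
have s_van : s \in vanishing K u v by rewrite sub_ord // mem_rcons mem_head.
move=> t_ord; rewrite /transfer foldl_rcons -/(transfer v a ord).
rewrite (transfer_step_vanishing _ s_van (sub_ord _ t_ord)).
case: (s =P t) => // /eqP neq_st.
rewrite IH // => [r r_ord|].
  by rewrite sub_ord // mem_rcons inE r_ord orbT.
by move: t_ord; rewrite mem_rcons inE eq_sym (negPf neq_st).
Qed.

End Transfer.

(** * Mirror simplices and the fibres of the collapse *)

Section Collapse.
Variables (V : finType) (K : {set {set V}}) (u v : V) (g : nat -> nat).
Hypothesis K_complex : simplicial_complex K.
Hypothesis neq_uv : u != v.
Hypothesis K_link : link_condition K u v.

(** A nonempty [w] lies in the links of [u] and of [v], hence in the link of the edge. Links contain
    only nonempty simplices, so empty [w] is separate: the join is then the edge itself. *)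
Lemma mirror_join (w : {set V}) :
  u \notin w -> v \notin w -> u |: w \in K -> v |: w \in K ->
  u |: (v |: w) \in K.
Proof.
move=> uw vw uwK vwK; have [uvK linkE] := K_link.
have [-> | w_neq0] := eqVneq w set0; first by rewrite setU0.
have wK : w \in K.
  by have [_ /(_ _ w uwK (subsetUr _ _))] := K_complex; apply.
have : w \in link K [set u] :&: link K [set v].
  rewrite !inE wK ![[disjoint w & _]]disjoint_sym !disjoints1.
  by rewrite ![w :|: _]setUC uw vw uwK.
by rewrite linkE => /setIdP[_ /andP[_]]; rewrite setUC -setUA.
Qed.

(** All faces of the join of [w] with the edge contain both [u] and [v], except [s] and [t], so the
    cocycle equation there reads [c s + c t = 0]. *)
Lemma cocycle_mirror p (c : cochain K p) (w : {set V}) (s t : psimplex K p) :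
  c \in cocycles K p ->
  (forall r : psimplex K p, (r : {set V}) \in vanishing K u v -> c r = 0) ->
  u \notin w -> v \notin w -> s = u |: w :> {set V} -> t = v |: w :> {set V} ->
  c s = c t.
Proof.
move=> /cocycleP cZ c0 uw vw sE tE.
have cS : #|u |: (v |: w)| == p.+2.
  by rewrite -tE cardsU1 card_psimplex tE !inE (negPf neq_uv) (negPf uw).
have SP : (u |: (v |: w) \in K) && (#|u |: (v |: w)| == p.+2).
  by rewrite cS mirror_join // -?sE -?tE psimplex_in.
pose S := PSimplex SP.
have uS : u \in (S : {set V}) by rewrite setU11.
have vS : v \in (S : {set V}) by rewrite setU1r ?setU11.
have Su : S :\ u = t by rewrite tE setU1K // !inE negb_or neq_uv.
have Sv : S :\ v = s.
  by rewrite sE /= setUCA setU1K // !inE negb_or eq_sym neq_uv.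
have cr (r : psimplex K p) :
    u \in (r : {set V}) -> v \in (r : {set V}) -> c r = 0.
  by move=> ur vr; rewrite c0 // inE psimplex_in ur.
have := coboundary_two_faces K_complex neq_uv uS vS cr.
rewrite cZ ffunE (eval_setE _ Su) (eval_setE _ Sv) => ts.
by rewrite -[LHS]add0r ts -addrA addrrF2 addr0.
Qed.

Lemma collapse_imset (s : {set V}) :
  collapse_map u v @: s = if v \in s then u |: s :\ v else s.
Proof.
have fD (A : {set V}) : v \notin A -> collapse_map u v @: A = A.
  move=> vA; rewrite -[RHS]imset_id; apply: eq_in_imset => x xA.
  by rewrite /collapse_map; case: eqP => // xv; rewrite -xv xA in vA.
case: ifP => [vs|/negbT]; last exact: fD.
by rewrite -{1}(setD1K vs) imsetU1 fD ?setD11 // /collapse_map eqxx.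
Qed.

Lemma card_collapse (s : {set V}) :
  #|collapse_map u v @: s| = (#|s| - ((u \in s) && (v \in s)))%N.
Proof.
rewrite collapse_imset; case: ifP => vs; last by rewrite andbF subn0.
rewrite cardsU1 !inE neq_uv [in RHS](cardsD1 v s) vs.
by case: (u \in s); rewrite ?subn0 // add1n subn1.
Qed.

(** [T] is the image of some [S], possibly of higher dimension. If [S] contains [u] and [v], then
    [T] is [S :\ v], which the map fixes; otherwise [S] already has the right dimension. *)
Lemma collapse_lift p (T : psimplex (collapse K u v) p) :
  exists s : psimplex K p, collapse_map u v @: (s : {set V}) = T.
Proof.
have [S SK TE] := imsetP (psimplex_in T).
have lift (s : {set V}) : s \in K -> #|s| = p.+1 ->
    collapse_map u v @: s = T ->
    exists s : psimplex K p, collapse_map u v @: (s : {set V}) = T.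
  move=> sK /eqP cs sT; have sP : (s \in K) && (#|s| == p.+1) by rewrite sK cs.
  by exists (PSimplex sP).
have cT := card_psimplex T; move: (TE); rewrite collapse_imset.
case: ifP => [vS|_] TE'; last by apply: (lift S) => //; rewrite -TE'.
have [uS|uS] := boolP (u \in S).
  have TE'' : T = S :\ v :> {set V}.
    by rewrite TE'; apply/setUidPr; rewrite sub1set !inE neq_uv.
  have [_ /(_ _ _ SK (subD1set S v)) SvK] := K_complex.
  apply: (lift (S :\ v)); rewrite -?TE'' //.
    by rewrite TE'' SvK // -TE'' -card_gt0 cT.
  by rewrite collapse_imset TE'' setD11.
by apply: (lift S) => //; rewrite -cT TE card_collapse (negPf uS) subn0.
Qed.

(** Two non-vanishing simplices with the same image are equal or mirror, so the choice made by
    [pick] in [collapse_annotation] does not matter. *)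
Lemma collapse_fiber p (c : cochain K p) (s t : psimplex K p) :
  c \in cocycles K p ->
  (forall r : psimplex K p, (r : {set V}) \in vanishing K u v -> c r = 0) ->
  ~~ ((u \in (s : {set V})) && (v \in (s : {set V}))) ->
  collapse_map u v @: (s : {set V}) = collapse_map u v @: (t : {set V}) ->
  c s = c t.
Proof.
move=> cZ c0 nvs fst.
(* The common image has [p.+1] vertices since [s] loses none, so [t] loses none either. *)
have nvt : ~~ ((u \in (t : {set V})) && (v \in (t : {set V}))).
  have := congr1 (fun A : {set V} => #|A|) fst.
  rewrite !card_collapse !card_psimplex (negPf nvs) subn0.
  by case: (_ && _) => // /eqP; rewrite subn1 gtn_eqF.
move: fst nvt; rewrite !collapse_imset.
have mirror (x y : psimplex K p) : v \in (x : {set V}) ->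
    ~~ ((u \in (x : {set V})) && (v \in (x : {set V}))) ->
    u |: x :\ v = y -> c y = c x.
  move=> vx; rewrite vx andbT => ux xy.
  apply: (cocycle_mirror (w := x :\ v)) => //;
    by rewrite ?setD1K ?inE ?eqxx ?(negPf ux) ?andbF.
(* If both or neither contain [v], the simplices coincide; if exactly one does, they are mirror. *)
case: ifP => vs; case: ifP => vt.
- move: nvs; rewrite vs !andbT => us fst ut; congr (c _); apply: val_inj.
  rewrite /= -(setD1K vs) -(setD1K vt); congr (_ |: _).
  rewrite -[LHS](@setU1K _ u) ?inE ?(negPf us) ?andbF // fst.
  by rewrite setU1K // !inE (negPf ut) andbF.
- by move=> fst _; apply/esym/mirror.
- by move=> fst ut; apply: mirror; rewrite ?vt.
- by move=> fst _; congr (c _); apply: val_inj.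
Qed.

(** On a vanishing simplex both sides are 0, the left one by degeneracy. On any other [s], the
    simplex picked over its image lies in the fibre of [s] and has the same value. *)
Lemma pullback_collapse (a : annotation K g) p (i : 'I_(g p)) :
  annotation_cochain (a p) i \in cocycles K p ->
  (forall r : psimplex K p, (r : {set V}) \in vanishing K u v -> a p r = 0) ->
  pullback K (collapse_map u v)
    (annotation_cochain (collapse_annotation u v a p) i)
  = annotation_cochain (a p) i.
Proof.
move=> aZ a0; have c0 (r : psimplex K p) : (r : {set V}) \in vanishing K u v ->
    annotation_cochain (a p) i r = 0 by move=> /a0 r0; rewrite ffunE r0 mxE.
apply/ffunP=> s; rewrite ffunE -/(eval_set _ _).
have [/andP[us vs]|nvs] :=
  boolP ((u \in (s : {set V})) && (v \in (s : {set V}))).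
  rewrite c0 ?inE ?psimplex_in ?us //.
  apply: (eval_set_degenerate _ (card_psimplex s) us vs neq_uv).
  by rewrite /collapse_map eqxx (negPf neq_uv).
rewrite /eval_set; case: insubP => [t _ tE|] /=; last first.
  rewrite imset_f ?psimplex_in //= card_collapse (negPf nvs) subn0.
  by rewrite card_psimplex eqxx.
rewrite ffunE /collapse_annotation; case: pickP => [s' /eqP s'E|/(_ s)].
  rewrite -(ffunE (fun s => a p s 0 i)); apply/esym/collapse_fiber => //.
  by rewrite -tE s'E.
by rewrite -tE eqxx.
Qed.

End Collapse.

(** The cocycle memberships belong to the conclusion because [cohclass] is meaningful only on
    cocycles. The vanishing simplices may be processed in any order [ord]. *)
Theorem proposition5p3 (V : finType) (K : {set {set V}}) (u v : V)
    (g : nat -> nat) (a : annotation K g) (ord : seq {set V})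
    (K_complex : simplicial_complex K) (neq_uv : u != v)
    (K_link : link_condition K u v)
    (a_valid : forall q, valid_annotation (a q))
    (ord_vanishing : perm_eq ord (enum (vanishing K u v)))
    (p : nat) (i : 'I_(g p)) :
  let phi := annotation_cochain (a p) i in
  let phi' := annotation_cochain (update u v a ord p) i in
  [/\ phi \in cocycles K p, phi' \in cocycles (collapse K u v) p
    & cohclass phi = induced K (collapse_map u v) (cohclass phi')].
Proof.
move=> phi phi'; have phiZ : phi \in cocycles K p by exact: annotation_cocycle.
have ordE : ord =i vanishing K u v.
  by move=> s; rewrite (perm_mem ord_vanishing) mem_enum.
have sub_ord : {subset ord <= vanishing K u v} by move=> s; rewrite ordE.
pose psi := annotation_cochain (transfer v a ord p) i.
have psi_phi : psi - phi \in coboundaries K p.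
  by apply: (transfer_coboundary K_complex neq_uv).
have psiZ : psi \in cocycles K p.
  rewrite -(subrK phi psi) memvD //.
  exact: subvP (coboundaries_cocycles K_complex p) _ psi_phi.
have pull_phi' : pullback K (collapse_map u v) phi' = psi.
  apply: pullback_collapse => // r rV.
  by apply: transfer_vanishing sub_ord _; rewrite ordE.
have simpl s : s \in K -> collapse_map u v @: (s : {set V}) \in collapse K u v.
  by move=> sK; apply/imsetP; exists s.
(* Lift [T] to [S] of the same dimension: the coboundary of [phi'] at [T] is its pullback at [S],
   which is the coboundary of [psi] at [S], hence 0. *)
have phi'Z : phi' \in cocycles (collapse K u v) p.
  apply/cocycleP/ffunP => T; have [S TE] := collapse_lift K_complex neq_uv T.
  rewrite -(eval_setE _ TE) -(eval_pullback (K := K)) ?psimplex_in //;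
    last exact: card_psimplex.
  rewrite pullback_coboundary // pull_phi' (cocycleP _ psiZ).
  by rewrite (eval_setE _ (erefl _)) !ffunE.
split=> //; rewrite cohclass_pullback // pull_phi'.
by apply: cohclass_eq; rewrite // -opprB memvN.
Qed.
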